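(* Let $\bar x\in X$ be a W-stationary (respectively M-stationary, S-stationary) point of (MPOC). Let $\bar y,\bar z\in\mathbb R^q$ be defined, for all $l\in\mathcal Q$, by $$\bar y_l:=\begin{cases}0 & l\in I^{-0}(\bar x)\cup I^{-+}(\bar x)\cup I^{0+}(\bar x)\cup I^{--}(\bar x)\cup I^{00}(\bar x),\\ 1& l\in I^{0-}(\bar x),\\ 2G_l(\bar x)& l\in I^{+-}(\bar x)\cup I^{+0}(\bar x),\end{cases}$$ $$\bar z_l:=\begin{cases}0 & l\in I^{0-}(\bar x)\cup I^{+-}(\bar x)\cup I^{+0}(\bar x)\cup I^{--}(\bar x)\cup I^{00}(\bar x),\\ 1& l\in I^{-0}(\bar x),\\ 2H_l(\bar x)& l\in I^{-+}(\bar x)\cup I^{0+}(\bar x).\end{cases}$$ Then $(\bar x,\bar y,\bar z)$ is C$_{\mathrm{CC}}$-stationary (respectively M$_{\mathrm{CC}}$-stationary, S$_{\mathrm{CC}}$-stationary) for the complementarity-constrained program $$\text{(CC-MPOC)}\qquad \min_{x,y,z} f(x)\ \text{ s.t. }\ g_i(x)\le 0\ (i\in\mathcal M),\ h_j(x)=0\ (j\in\mathcal P),\ G_l(x)-y_l\le 0,\ H_l(x)-z_l\le0,\ 0\le y_l\perp z_l\ge0\ (l\in\mathcal Q).$$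
   Context: Let $n,m,p,q$ be positive integers, $\mathcal M:=\{1,\dots,m\}$, $\mathcal P:=\{1,\dots,p\}$, $\mathcal Q:=\{1,\dots,q\}$, and let $f,g_i,h_j,G_l,H_l\colon\mathbb R^n\to\mathbb R$ be continuously differentiable for all $i\in\mathcal M$, $j\in\mathcal P$, $l\in\mathcal Q$. The program (MPOC) is: minimize $f(x)$ subject to $g_i(x)\le 0$ ($i\in\mathcal M$), $h_j(x)=0$ ($j\in\mathcal P$), and ($G_l(x)\le 0$ or $H_l(x)\le 0$) for all $l\in\mathcal Q$. Its feasible set is $X$. The notation $0\le a\perp b\ge0$ means $a\ge0$, $b\ge0$, $ab=0$. For $\bar x\in X$ put $I^g(\bar x):=\{i\in\mathcal M: g_i(\bar x)=0\}$. The index sets $I^{st}(\bar x)\subset\mathcal Q$ with $s,t\in\{-,0,+\}$ (excluding $s=t=+$, which cannot occur) consist of those $l\in\mathcal Q$ for which $G_l(\bar x)$ has sign $s$ and $H_l(\bar x)$ has sign $t$; e.g. $I^{-0}(\bar x)=\{l: G_l(\bar x)<0,\ H_l(\bar x)=0\}$, $I^{00}(\bar x)=\{l: G_l(\bar x)=H_l(\bar x)=0\}$. These eight sets partition $\mathcal Q$. A point $\bar x\in X$ is W-stationary for (MPOC) if there are multipliers $\lambda_i\ge0$ ($i\in I^g(\bar x)$), $\rho_j\in\mathbb R$ ($j\in\mathcal P$), $\mu_l\ge 0$ ($l\in I^{0+}(\bar x)\cup I^{00}(\bar x)$), $\nu_l\ge0$ ($l\in I^{+0}(\bar x)\cup I^{00}(\bar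 x)$) with $$0=\nabla f(\bar x)+\sum_{i\in I^g(\bar x)}\lambda_i\nabla g_i(\bar x)+\sum_{j\in\mathcal P}\rho_j\nabla h_j(\bar x)+\sum_{l\in I^{0+}(\bar x)\cup I^{00}(\bar x)}\mu_l\nabla G_l(\bar x)+\sum_{l\in I^{+0}(\bar x)\cup I^{00}(\bar x)}\nu_l\nabla H_l(\bar x).$$ It is M-stationary (resp. S-stationary) if such multipliers exist with additionally $\mu_l\nu_l=0$ (resp. $\mu_l=0$ and $\nu_l=0$) for all $l\in I^{00}(\bar x)$. Stationarity for complementarity-constrained programs: consider a program in a variable $w$: $\min F(w)$ s.t. $c_i(w)\le0$, $e_j(w)=0$, $0\le\bar G_l(w)\perp\bar H_l(w)\ge0$ ($l\in\mathcal Q$) with continuously differentiable data, and a feasible point $\bar w$. Let $I^{0+}_{\mathrm{CC}}:=\{l:\bar G_l(\bar w)=0,\bar H_l(\bar w)>0\}$, $I^{+0}_{\mathrm{CC}}:=\{l:\bar G_l(\bar w)>0,\bar H_l(\bar w)=0\}$, $I^{00}_{\mathrm{CC}}:=\{l:\bar G_l(\bar w)=\bar H_l(\bar w)=0\}$. Then $\bar w$ is W$_{\mathrm{CC}}$-stationary if there are $\lambda_i\ge0$ ($i$ with $c_i(\bar w)=0$), $\rho_j\in\mathbb R$, $\bar\mu_l\in\mathbb R$ ($l\in I^{0+}_{\mathrm{CC}}\cup I^{00}_{\mathrm{CC}}$), $\bar\nu_l\in\mathbb R$ ($l\in I^{+0}_{\mathrm{CC}}\cup I^{00}_{\mathrm{CC}}$)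 with $$0=\nabla F(\bar w)+\sum_{i:\,c_i(\bar w)=0}\lambda_i\nabla c_i(\bar w)+\sum_j\rho_j\nabla e_j(\bar w)-\sum_{l\in I^{0+}_{\mathrm{CC}}\cup I^{00}_{\mathrm{CC}}}\bar\mu_l\nabla\bar G_l(\bar w)-\sum_{l\in I^{+0}_{\mathrm{CC}}\cup I^{00}_{\mathrm{CC}}}\bar\nu_l\nabla\bar H_l(\bar w).$$ It is C$_{\mathrm{CC}}$-stationary if such multipliers exist with $\bar\mu_l\bar\nu_l\ge0$ for all $l\in I^{00}_{\mathrm{CC}}$; M$_{\mathrm{CC}}$-stationary if such multipliers exist with $\bar\mu_l\bar\nu_l=0$ or ($\bar\mu_l>0$ and $\bar\nu_l>0$) for all $l\in I^{00}_{\mathrm{CC}}$; S$_{\mathrm{CC}}$-stationary if such multipliers exist with $\bar\mu_l\ge0$ and $\bar\nu_l\ge0$ for all $l\in I^{00}_{\mathrm{CC}}$. For (CC-MPOC) these notions are used with $w=(x,y,z)$, $F(w)=f(x)$, inequality constraints $g_i(x)\le0$, $G_l(x)-y_l\le0$, $H_l(x)-z_l\le0$, equality constraints $h_j(x)=0$, and $\bar G_l(w)=y_l$, $\bar H_l(w)=z_l$. *)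

(* Defs.v *)
From mathcomp Require Import all_boot all_order all_algebra.
From mathcomp Require Import all_classical all_reals all_analysis.

Set Implicit Arguments.
Unset Strict Implicit.
Unset Printing Implicit Defensive.

Import Order.TTheory GRing.Theory Num.Theory.
Import numFieldNormedType.Exports.

Local Open Scope ring_scope.

Definition gradient (R : realType) (n : nat) (f : 'rV[R]_n -> R)
    (x : 'rV[R]_n) : 'rV[R]_n :=
  \row_(i < n) 'D_(delta_mx 0 i) f x.

Definition cont_diff (R : realType) (n : nat) (f : 'rV[R]_n -> R) : Prop :=
  (forall x : 'rV[R]_n, differentiable f x) /\ continuous (gradient f).

(** Or-constrained programs: min f(x) s.t. g_i(x) <= 0, h_j(x) = 0, and
    G_l(x) <= 0 or H_l(x) <= 0. *)

Record mpoc (R : realType) (n m p q : nat) := Mpoc {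
  oc_f : 'rV[R]_n -> R;
  oc_g : 'I_m -> 'rV[R]_n -> R;
  oc_h : 'I_p -> 'rV[R]_n -> R;
  oc_G : 'I_q -> 'rV[R]_n -> R;
  oc_H : 'I_q -> 'rV[R]_n -> R }.

Section OrConstrained.
Variables (R : realType) (n m p q : nat) (P : mpoc R n m p q).
Implicit Type x : 'rV[R]_n.

Definition oc_smooth : Prop :=
  cont_diff (oc_f P) /\
  [/\ forall i, cont_diff (oc_g P i),
      forall j, cont_diff (oc_h P j),
      forall l, cont_diff (oc_G P l)
    & forall l, cont_diff (oc_H P l)].

Definition oc_feasible x : Prop :=
  [/\ forall i, oc_g P i x <= 0,
      forall j, oc_h P j x = 0
    & forall l, oc_G P l x <= 0 \/ oc_H P l x <= 0].

Definition oc_active x : {set 'I_m} := [set i | oc_g P i x == 0].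

(** I^{st}(x), the signs -, 0, + being given by -1, 0, 1. *)
Definition oc_I x (s t : R) : {set 'I_q} :=
  [set l | (Num.sg (oc_G P l x) == s) && (Num.sg (oc_H P l x) == t)].

(** Multipliers are total functions; only their values on the index sets named
    in the sums and in the sign conditions matter. *)
Definition oc_multipliers x (lam : 'I_m -> R) (rho : 'I_p -> R)
    (mu nu : 'I_q -> R) : Prop :=
  [/\ forall i, i \in oc_active x -> 0 <= lam i,
      forall l, l \in oc_I x 0 1 :|: oc_I x 0 0 -> 0 <= mu l,
      forall l, l \in oc_I x 1 0 :|: oc_I x 0 0 -> 0 <= nu l
    & 0 = gradient (oc_f P) x
        + \sum_(i in oc_active x) lam i *: gradient (oc_g P i) x
        + \sum_(j < p) rho j *: gradient (oc_h P j) x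
        + \sum_(l in oc_I x 0 1 :|: oc_I x 0 0) mu l *: gradient (oc_G P l) x
        + \sum_(l in oc_I x 1 0 :|: oc_I x 0 0) nu l *: gradient (oc_H P l) x].

Definition W_stationary x : Prop :=
  oc_feasible x /\ exists lam rho mu nu, oc_multipliers x lam rho mu nu.

Definition M_stationary x : Prop :=
  oc_feasible x /\ exists lam rho mu nu, oc_multipliers x lam rho mu nu /\
    forall l, l \in oc_I x 0 0 -> mu l * nu l = 0.

Definition S_stationary x : Prop :=
  oc_feasible x /\ exists lam rho mu nu, oc_multipliers x lam rho mu nu /\
    forall l, l \in oc_I x 0 0 -> mu l = 0 /\ nu l = 0.

(** For feasible x, the last branch is I^{+-}(x) or I^{+0}(x). *)
Definition ybar x : 'rV[R]_q :=
  \row_(l < q)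
    if l \in oc_I x (-1) 0 :|: oc_I x (-1) 1 :|: oc_I x 0 1
             :|: oc_I x (-1) (-1) :|: oc_I x 0 0 then 0
    else if l \in oc_I x 0 (-1) then 1
    else 2 * oc_G P l x.

(** For feasible x, the last branch is I^{-+}(x) or I^{0+}(x). *)
Definition zbar x : 'rV[R]_q :=
  \row_(l < q)
    if l \in oc_I x 0 (-1) :|: oc_I x 1 (-1) :|: oc_I x 1 0
             :|: oc_I x (-1) (-1) :|: oc_I x 0 0 then 0
    else if l \in oc_I x (-1) 0 then 1
    else 2 * oc_H P l x.

End OrConstrained.

(** Complementarity-constrained programs: min F(w) s.t. c_i(w) <= 0,
    e_j(w) = 0, and 0 <= G_l(w) _|_ H_l(w) >= 0. *)

Record mpcc (R : realType) (d : nat) (I J L : finType) := Mpcc {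
  cc_F : 'rV[R]_d -> R;
  cc_c : I -> 'rV[R]_d -> R;
  cc_e : J -> 'rV[R]_d -> R;
  cc_G : L -> 'rV[R]_d -> R;
  cc_H : L -> 'rV[R]_d -> R }.

Section ComplementarityConstrained.
Variables (R : realType) (d : nat) (I J L : finType) (P : mpcc R d I J L).
Implicit Type w : 'rV[R]_d.

Definition cc_feasible w : Prop :=
  [/\ forall i, cc_c P i w <= 0,
      forall j, cc_e P j w = 0
    & forall l, [/\ 0 <= cc_G P l w, 0 <= cc_H P l w
                  & cc_G P l w * cc_H P l w = 0]].

Definition cc_active w : {set I} := [set i | cc_c P i w == 0].

Definition cc_I0p w : {set L} := [set l | (cc_G P l w == 0) && (0 < cc_H P l w)].
Definition cc_Ip0 w : {set L} := [set l | (0 < cc_G P l w) && (cc_H P l w == 0)].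
Definition cc_I00 w : {set L} := [set l | (cc_G P l w == 0) && (cc_H P l w == 0)].

Definition cc_multipliers w (lam : I -> R) (rho : J -> R)
    (mu nu : L -> R) : Prop :=
  (forall i, i \in cc_active w -> 0 <= lam i) /\
  0 = gradient (cc_F P) w
      + \sum_(i in cc_active w) lam i *: gradient (cc_c P i) w
      + \sum_(j : J) rho j *: gradient (cc_e P j) w
      - \sum_(l in cc_I0p w :|: cc_I00 w) mu l *: gradient (cc_G P l) w
      - \sum_(l in cc_Ip0 w :|: cc_I00 w) nu l *: gradient (cc_H P l) w.

Definition C_CC_stationary w : Prop :=
  cc_feasible w /\ exists lam rho mu nu, cc_multipliers w lam rho mu nu /\
    forall l, l \in cc_I00 w -> 0 <= mu l * nu l.

Definition M_CC_stationary w : Prop :=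
  cc_feasible w /\ exists lam rho mu nu, cc_multipliers w lam rho mu nu /\
    forall l, l \in cc_I00 w -> mu l * nu l = 0 \/ (0 < mu l /\ 0 < nu l).

Definition S_CC_stationary w : Prop :=
  cc_feasible w /\ exists lam rho mu nu, cc_multipliers w lam rho mu nu /\
    forall l, l \in cc_I00 w -> 0 <= mu l /\ 0 <= nu l.

End ComplementarityConstrained.

(** The variable w = (x, y, z) of (CC-MPOC) is a row vector of length
    n + (q + q). *)

Definition ccvar (R : realType) (n q : nat) (x : 'rV[R]_n) (y z : 'rV[R]_q) :
    'rV[R]_(n + (q + q)) :=
  row_mx x (row_mx y z).

Definition ccx (R : realType) (n q : nat) (w : 'rV[R]_(n + (q + q))) :
    'rV[R]_n := lsubmx w.
Definition ccy (R : realType) (n q : nat) (w : 'rV[R]_(n + (q + q))) :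
    'rV[R]_q := lsubmx (rsubmx w).
Definition ccz (R : realType) (n q : nat) (w : 'rV[R]_(n + (q + q))) :
    'rV[R]_q := rsubmx (rsubmx w).

Definition cc_mpoc (R : realType) (n m p q : nat) (P : mpoc R n m p q) :
    mpcc R (n + (q + q)) ('I_m + 'I_q + 'I_q)%type 'I_p 'I_q :=
  {| cc_F := fun w => oc_f P (ccx w);
     cc_c := fun i w => match i with
       | inl (inl i) => oc_g P i (ccx w)
       | inl (inr l) => oc_G P l (ccx w) - ccy w 0 l
       | inr l => oc_H P l (ccx w) - ccz w 0 l
       end;
     cc_e := fun j w => oc_h P j (ccx w);
     cc_G := fun l w => ccy w 0 l;
     cc_H := fun l w => ccz w 0 l |}.

(* Main.v *)
Require Import Defs.
From mathcomp Require Import all_boot all_order all_algebra.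
From mathcomp Require Import all_classical all_reals all_analysis.
From mathcomp Require Import lra.

(** Each disjunction is lifted to a complementarity pair (y_l, z_l), and the
    values of [ybar] and [zbar] are chosen so that a lifted inequality
    G_l(x) <= y_l is active exactly when the multiplier mu_l occurs in the
    or-constrained system, that is on I^{0+} and I^{00}: whenever G_l(x) = 0
    with H_l(x) < 0, or G_l(x) > 0, the positive value of y_l makes the
    inequality slack.  The same holds for H_l(x) <= z_l and nu_l
    ([active_G], [active_H]).

    One may therefore keep lambda and rho, and give the multipliers mu_l and
    nu_l to the lifted inequalities.  The x-block of the stationarity equation
    is then the given one.  The gradient of G_l(x) - y_l contributes -mu_l to
    the y_l-component, so the multiplier of the constraint 0 <= y_l has to be
    -mu_l, and 0 off I^{0+} and I^{00}; likewise for z ([lift_multipliers]).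

    The biactive indices are those of I^{00} and of I^{--} ([biactive]).  On
    I^{--} both new multipliers vanish.  On I^{00} they are -mu_l and -nu_l, so
    their product is mu_l nu_l >= 0, which is C-stationarity; it is zero in the
    M-stationary case, and both factors are zero in the S-stationary case. *)

Set Implicit Arguments.
Unset Strict Implicit.
Unset Printing Implicit Defensive.

Import Order.TTheory GRing.Theory Num.Theory.
Import numFieldNormedType.Exports.

Local Open Scope ring_scope.

(** * Gradients of the lifted data *)

Section LiftedGradients.
Variables (R : realType) (n q : nat).
Implicit Types (w : 'rV[R]_(n + (q + q))) (f : 'rV[R]_n -> R).

(** As [ccx] is linear, the difference quotients of a function of the x-block
    along v are those of the function itself along [ccx v]; derivatives and
    derivability transfer without any chain rule. *)
Lemma lift_quotient f w v :
  (fun h : R => h^-1 *: (f (ccx (h *: v + w)) - f (ccx w))) =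
  (fun h : R => h^-1 *: (f (h *: ccx v + ccx w) - f (ccx w))).
Proof.
by apply/funext => h; congr (_ *: (f _ - _)); apply/rowP => i; rewrite !mxE.
Qed.

Lemma derive_lift f w v :
  'D_v (fun w' => f (ccx w')) w = 'D_(ccx v) f (ccx w).
Proof. by rewrite /derive /= lift_quotient. Qed.

Lemma derivable_lift f w v : differentiable f (ccx w) ->
  derivable (fun w' => f (ccx w')) w v.
Proof.
by move=> /(diff_derivable (v := ccx v)); rewrite /derivable /= lift_quotient.
Qed.

Lemma derive_coord d (w v : 'rV[R]_d) k :
  'D_v (fun w' : 'rV[R]_d => w' 0 k) w = v 0 k.
Proof.
(* The difference quotient of a linear function is constant off h = 0. *)
apply: lim_near_cst => //; near=> h.
rewrite /= !mxE addrK /GRing.scale /= mulKf //.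
near: h; exact: nbhs_dnbhs_neq.
Unshelve. all: by end_near. Qed.

Lemma gradient_lift f w :
  gradient (fun w' => f (ccx w')) w = ccvar (gradient f (ccx w)) 0 0.
Proof.
apply/rowP => k; rewrite /ccvar !mxE derive_lift.
case: splitP => j jk; rewrite mxE.
  congr ('D_ _ f _); apply/rowP => i; rewrite !mxE.
  by congr ((_ && _)%:R); rewrite -val_eqE /= jk.
(* Along a y- or z-direction the x-block does not move. *)
rewrite (_ : ccx (delta_mx 0 k) = 0) ?derive0.
  by case: splitP => ? _; rewrite mxE.
apply/rowP => i; rewrite !mxE eqxx -val_eqE /= jk.
by rewrite ltn_eqF // ltn_addr.
Qed.

Lemma gradient_coord d (w : 'rV[R]_d) k :
  gradient (fun w' : 'rV[R]_d => w' 0 k) w = delta_mx 0 k.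
Proof. by apply/rowP => j; rewrite !mxE derive_coord !mxE !eqxx eq_sym. Qed.

Lemma gradientB d (f g : 'rV[R]_d -> R) (u : 'rV[R]_d) :
  (forall v, derivable f u v) -> (forall v, derivable g u v) ->
  gradient (fun u' => f u' - g u') u = gradient f u - gradient g u.
Proof. by move=> df dg; apply/rowP => k; rewrite !mxE; exact: deriveB. Qed.

Lemma gradient_ccy w l :
  gradient (fun w' : 'rV[R]_(n + (q + q)) => ccy w' 0 l) w
  = ccvar 0 (delta_mx 0 l) 0.
Proof.
rewrite (_ : (fun _ => _) = fun w' => w' 0 (rshift n (lshift q l))); last first.
  by apply/funext => w'; rewrite !mxE.
by rewrite gradient_coord delta_mx_rshift delta_mx_lshift.
Qed.

Lemma gradient_ccz w l :
  gradient (fun w' : 'rV[R]_(n + (q + q)) => ccz w' 0 l) w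
  = ccvar 0 0 (delta_mx 0 l).
Proof.
rewrite (_ : (fun _ => _) = fun w' => w' 0 (rshift n (rshift q l))); last first.
  by apply/funext => w'; rewrite !mxE.
by rewrite gradient_coord !delta_mx_rshift.
Qed.

Lemma gradient_lift_ccy f w l : differentiable f (ccx w) ->
  gradient (fun w' => f (ccx w') - ccy w' 0 l) w
  = ccvar (gradient f (ccx w)) (- delta_mx 0 l) 0.
Proof.
move=> df; rewrite gradientB.
- rewrite gradient_lift gradient_ccy /ccvar opp_row_mx add_row_mx subr0.
  by rewrite opp_row_mx add_row_mx subr0 sub0r.
- by move=> v; exact: derivable_lift.
- move=> v; rewrite (_ : (fun _ => _) = fun w' => w' 0 (rshift n (lshift q l))).
    exact/diff_derivable/differentiable_coord.
  by apply/funext => w'; rewrite !mxE.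
Qed.

Lemma gradient_lift_ccz f w l : differentiable f (ccx w) ->
  gradient (fun w' => f (ccx w') - ccz w' 0 l) w
  = ccvar (gradient f (ccx w)) 0 (- delta_mx 0 l).
Proof.
move=> df; rewrite gradientB.
- rewrite gradient_lift gradient_ccz /ccvar opp_row_mx add_row_mx subr0.
  by rewrite opp_row_mx add_row_mx subr0 sub0r.
- by move=> v; exact: derivable_lift.
- move=> v; rewrite (_ : (fun _ => _) = fun w' => w' 0 (rshift n (rshift q l))).
    exact/diff_derivable/differentiable_coord.
  by apply/funext => w'; rewrite !mxE.
Qed.

End LiftedGradients.

(** * Gradient equations in blocks *)

Section BlockSums.
Variables (R : realType) (n q : nat).

Lemma ccvarD (a a' : 'rV[R]_n) (b b' c c' : 'rV[R]_q) :
  ccvar a b c + ccvar a' b' c' = ccvar (a + a') (b + b') (c + c').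
Proof. by rewrite /ccvar !add_row_mx. Qed.

Lemma ccvarN (a : 'rV[R]_n) (b c : 'rV[R]_q) :
  - ccvar a b c = ccvar (- a) (- b) (- c).
Proof. by rewrite /ccvar !opp_row_mx. Qed.

Lemma ccvar0 : ccvar 0 0 0 = 0 :> 'rV[R]_(n + (q + q)).
Proof. by rewrite /ccvar !row_mx0. Qed.

Lemma sum_row_mx d d' (T : finType) (A : pred T)
    (F : T -> 'rV[R]_d) (G : T -> 'rV[R]_d') :
  \sum_(i | A i) row_mx (F i) (G i) =
  row_mx (\sum_(i | A i) F i) (\sum_(i | A i) G i).
Proof.
apply: (big_rec3 (fun b c a => a = row_mx b c)); first by rewrite row_mx0.
by move=> i b c _ _ ->; rewrite add_row_mx.
Qed.

Lemma ccvar_sum (T : finType) (A : pred T) (k : T -> R)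
    (F : T -> 'rV[R]_n) (G H : T -> 'rV[R]_q) :
  \sum_(i | A i) k i *: ccvar (F i) (G i) (H i) =
  ccvar (\sum_(i | A i) k i *: F i) (\sum_(i | A i) k i *: G i)
        (\sum_(i | A i) k i *: H i).
Proof.
rewrite /ccvar -!sum_row_mx.
by apply: eq_bigr => i _; rewrite !scale_row_mx.
Qed.

Lemma sum_scaler0 d (T : finType) (A : pred T) (k : T -> R) :
  \sum_(i | A i) k i *: (0 : 'rV[R]_d) = 0.
Proof. by apply: big1 => i _; rewrite scaler0. Qed.

(** The left side is the contribution of the active lifted inequalities to the
    y- or z-block, the right side that of the sign constraints on the lifting
    variables: the latter have more active indices, and the multipliers are
    negated on A and extended by zero. *)
Lemma sum_delta_opp (A B : {set 'I_q}) (k : 'I_q -> R) : A \subset B ->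
  \sum_(l in A) k l *: - delta_mx 0 l =
  \sum_(l in B) (if l \in A then - k l else 0) *: delta_mx 0 l :> 'rV[R]_q.
Proof.
move=> AB; rewrite [LHS]big_mkcond [RHS]big_mkcond; apply: eq_bigr => l _.
case: ifP => [/(fintype.subsetP AB)->|_]; first by rewrite scalerN scaleNr.
by rewrite scale0r if_same.
Qed.

End BlockSums.

(** * Active constraints at the lifted point *)

Section LiftValue.
Variable R : realType.
Implicit Types a b : R.

(** The common shape of [ybar] and [zbar] at feasible points: the value of the
    lifting variable of the alternative a <= 0 in the disjunction (a <= 0 or
    b <= 0).  When b < 0 the alternative a <= 0 is redundant, and the value 1 at
    a = 0 keeps a <= y from being active there. *)
Definition lift_value a b : R :=
  if 0 < a then 2 * a else if (a == 0) && (b < 0) then 1 else 0.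

Lemma lift_value_ge0 a b : 0 <= lift_value a b.
Proof. by rewrite /lift_value; case: (ltrgt0P a) => //= *; [lra|case: ifP]. Qed.

Lemma lift_value_ge a b : a <= lift_value a b.
Proof.
rewrite /lift_value; case: (ltrgt0P a) => /= a0; [lra|lra|].
by rewrite a0; case: ifP.
Qed.

Lemma lift_value_eq0 a b :
  (lift_value a b == 0) = (a < 0) || (a == 0) && (0 <= b).
Proof.
rewrite /lift_value; case: (ltrgt0P a) => /= a0; rewrite ?eqxx //.
  by apply/negP => /eqP; lra.
by case: (leP 0 b); rewrite ?eqxx ?oner_eq0.
Qed.

Lemma lift_value_active a b :
  (a - lift_value a b == 0) = (a == 0) && (0 <= b).
Proof.
rewrite /lift_value; case: (ltrgt0P a) => /= a0.
- by apply/negP => /eqP; lra.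
- by apply/negP => /eqP; lra.
- by rewrite a0 sub0r oppr_eq0; case: (leP 0 b); rewrite ?eqxx ?oner_eq0.
Qed.

Lemma lift_value_compl a b :
  a <= 0 \/ b <= 0 -> lift_value a b * lift_value b a = 0.
Proof.
rewrite /lift_value; case: (ltrgt0P a) => a0; case: (ltrgt0P b) => b0 /= ab;
  rewrite ?mulr0 ?mul0r //; case: ab; lra.
Qed.

End LiftValue.

Lemma gt0_or_eq0 (R : realType) (a : R) : (0 < a) || (a == 0) = (0 <= a).
Proof. by rewrite le_eqVlt orbC eq_sym. Qed.

Section ComplementarityIndices.
Variables (R : realType) (d : nat) (I J L : finType) (P : mpcc R d I J L).
Variables (w : 'rV[R]_d) (feas : cc_feasible P w).

(** Feasibility makes H_l >= 0, so the case distinction between H_l > 0 and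
    H_l = 0 is exhaustive. *)
Lemma mem_cc_G0 l : (l \in cc_I0p P w :|: cc_I00 P w) = (cc_G P l w == 0).
Proof.
have [_ _ /(_ l) [_ H0 _]] := feas; rewrite !inE -andb_orr.
by rewrite gt0_or_eq0 H0 andbT.
Qed.

Lemma mem_cc_H0 l : (l \in cc_Ip0 P w :|: cc_I00 P w) = (cc_H P l w == 0).
Proof.
have [_ _ /(_ l) [G0 _ _]] := feas; rewrite !inE -andb_orl.
by rewrite gt0_or_eq0 G0.
Qed.

End ComplementarityIndices.

Section LiftedPoint.
Variables (R : realType) (n m p q : nat) (P : mpoc R n m p q).
Variables (x : 'rV[R]_n) (feas : oc_feasible P x).
Implicit Type l : 'I_q.

Local Notation w := (ccvar x (ybar P x) (zbar P x)).
Local Notation muI := (oc_I P x 0 1 :|: oc_I P x 0 0).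
Local Notation nuI := (oc_I P x 1 0 :|: oc_I P x 0 0).

Lemma ccx_ccvar : ccx w = x. Proof. exact: row_mxKl. Qed.

Lemma ybarE l : ybar P x 0 l = lift_value (oc_G P l x) (oc_H P l x).
Proof.
have [_ _ /(_ l)] := feas; rewrite /lift_value mxE !inE !sgr_cp0.
by case: (ltrgt0P (oc_G P l x)) => ?; case: (ltrgt0P (oc_H P l x)) => ?;
  rewrite ?andbF ?andbT //= => -[].
Qed.

Lemma zbarE l : zbar P x 0 l = lift_value (oc_H P l x) (oc_G P l x).
Proof.
have [_ _ /(_ l)] := feas; rewrite /lift_value mxE !inE !sgr_cp0.
by case: (ltrgt0P (oc_G P l x)) => ?; case: (ltrgt0P (oc_H P l x)) => ?;
  rewrite ?andbF ?andbT //= => -[].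
Qed.

Lemma ccyE l : ccy w 0 l = lift_value (oc_G P l x) (oc_H P l x).
Proof. by rewrite -ybarE /ccy /ccvar row_mxKr row_mxKl. Qed.

Lemma cczE l : ccz w 0 l = lift_value (oc_H P l x) (oc_G P l x).
Proof. by rewrite -zbarE /ccz /ccvar !row_mxKr. Qed.

Lemma mem_muI l : (l \in muI) = (oc_G P l x == 0) && (0 <= oc_H P l x).
Proof. by rewrite !inE !sgr_cp0 -andb_orr gt0_or_eq0. Qed.

Lemma mem_nuI l : (l \in nuI) = (oc_H P l x == 0) && (0 <= oc_G P l x).
Proof. by rewrite !inE !sgr_cp0 -andb_orl gt0_or_eq0 andbC. Qed.

Lemma lift_feasible : cc_feasible (cc_mpoc P) w.
Proof.
have [gP hP orP] := feas; split => [[[i|l]|l]|j|l] /=; rewrite ?ccx_ccvar //.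
- by rewrite ccyE subr_le0 lift_value_ge.
- by rewrite cczE subr_le0 lift_value_ge.
- rewrite ccyE cczE; split; [exact: lift_value_ge0|exact: lift_value_ge0|].
  exact: lift_value_compl.
Qed.

Lemma active_g i :
  (inl (inl i) \in cc_active (cc_mpoc P) w) = (i \in oc_active P x).
Proof. by rewrite !inE /= ccx_ccvar. Qed.

Lemma active_G l : (inl (inr l) \in cc_active (cc_mpoc P) w) = (l \in muI).
Proof. by rewrite inE /= ccx_ccvar ccyE lift_value_active mem_muI. Qed.

Lemma active_H l : (inr l \in cc_active (cc_mpoc P) w) = (l \in nuI).
Proof. by rewrite inE /= ccx_ccvar cczE lift_value_active mem_nuI. Qed.

Lemma muI_sub_cc : muI \subset cc_I0p (cc_mpoc P) w :|: cc_I00 (cc_mpoc P) w.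
Proof.
apply/fintype.subsetP => l; rewrite mem_muI (mem_cc_G0 lift_feasible) /=.
by rewrite ccyE lift_value_eq0 => ->; rewrite orbT.
Qed.

Lemma nuI_sub_cc : nuI \subset cc_Ip0 (cc_mpoc P) w :|: cc_I00 (cc_mpoc P) w.
Proof.
apply/fintype.subsetP => l; rewrite mem_nuI (mem_cc_H0 lift_feasible) /=.
by rewrite cczE lift_value_eq0 => ->; rewrite orbT.
Qed.

(** The second alternative is I^{--}: there both lifting variables vanish
    although neither G_l nor H_l does. *)
Lemma biactive l : l \in cc_I00 (cc_mpoc P) w ->
  l \in oc_I P x 0 0 \/ (l \notin muI /\ l \notin nuI).
Proof.
rewrite mem_muI mem_nuI !inE /= ccyE cczE !lift_value_eq0 !sgr_cp0.
by case: (ltrgt0P (oc_G P l x)) => ?; case: (ltrgt0P (oc_H P l x)) => ? //=;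
  auto.
Qed.

(** * Transfer of the multipliers *)

Section Multipliers.
Variables (lam : 'I_m -> R) (rho : 'I_p -> R) (mu nu : 'I_q -> R).

Definition lift_lam (s : 'I_m + 'I_q + 'I_q) : R :=
  match s with inl (inl i) => lam i | inl (inr l) => mu l | inr l => nu l end.

Definition lift_mu l : R := if l \in muI then - mu l else 0.

Definition lift_nu l : R := if l \in nuI then - nu l else 0.

(** The three blocks of the gradient equation decouple: the x-block is the
    given equation, and in the y- and z-blocks the multiplier of each active
    lifted inequality cancels against that of the sign constraint on the
    lifting variable. *)
Lemma lift_multipliers : oc_smooth P -> oc_multipliers P x lam rho mu nu ->
  cc_multipliers (cc_mpoc P) w lift_lam rho lift_mu lift_nu.
Proof.
move=> [_ [_ _ GP HP]] [lam0 mu0 nu0 eq0]; split.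
  move=> [[i|l]|l]; rewrite ?active_g ?active_G ?active_H.
  - exact: lam0.
  - exact: mu0.
  - exact: nu0.
have diffG l : differentiable (oc_G P l) (ccx w) by have [] := GP l.
have diffH l : differentiable (oc_H P l) (ccx w) by have [] := HP l.
rewrite !big_sumType /=.
rewrite (eq_bigl _ _ active_g) (eq_bigl _ _ active_G) (eq_bigl _ _ active_H).
under eq_bigr do rewrite gradient_lift.
under [X in _ + (_ + X + _)]eq_bigr do rewrite gradient_lift_ccy //.
under [X in _ + (_ + _ + X)]eq_bigr do rewrite gradient_lift_ccz //.
under [X in _ + X - _ - _]eq_bigr do rewrite gradient_lift.
under [X in _ - X - _]eq_bigr do rewrite gradient_ccy.
under [X in _ - _ - X]eq_bigr do rewrite gradient_ccz.
rewrite gradient_lift !ccvar_sum !ccvarN !ccvarD ccx_ccvar !sum_scaler0.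
rewrite (sum_delta_opp mu muI_sub_cc) (sum_delta_opp nu nuI_sub_cc).
rewrite !(addr0, add0r, oppr0) !subrr -ccvar0; congr (ccvar _ 0 0).
by rewrite [LHS]eq0 !addrA [RHS]addrAC; congr (_ + _); rewrite addrAC.
Qed.

(** On I^{--} both new multipliers are 0, and on I^{00} they are the negated
    old ones, so a condition on biactive pairs is inherited as soon as it holds
    at (0, 0) and at (-mu_l, -nu_l) for l in I^{00}. *)
Lemma biactive_multipliers (C : R -> R -> Prop) : C 0 0 ->
  (forall l, l \in oc_I P x 0 0 -> C (- mu l) (- nu l)) ->
  forall l, l \in cc_I00 (cc_mpoc P) w -> C (lift_mu l) (lift_nu l).
Proof.
move=> C0 Cl l; rewrite /lift_mu /lift_nu => /biactive[l00|[]].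
  by rewrite !(finset.in_setU, l00) !orbT; exact: Cl.
by move=> /negPf-> /negPf->.
Qed.

End Multipliers.

End LiftedPoint.

(** * Stationarity of the lifted point *)

Theorem proposition4p6 (R : realType) (n m p q : nat)
    (n_gt0 : (0 < n)%N) (m_gt0 : (0 < m)%N) (p_gt0 : (0 < p)%N)
    (q_gt0 : (0 < q)%N)
    (P : mpoc R n m p q) (smoothP : oc_smooth P) (x : 'rV[R]_n) :
  (W_stationary P x ->
     C_CC_stationary (cc_mpoc P) (ccvar x (ybar P x) (zbar P x))) /\
  (M_stationary P x ->
     M_CC_stationary (cc_mpoc P) (ccvar x (ybar P x) (zbar P x))) /\
  (S_stationary P x ->
     S_CC_stationary (cc_mpoc P) (ccvar x (ybar P x) (zbar P x))).
Proof.
split; [|split] => -[feas [lam [rho [mu [nu]]]]].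
- move=> mult; have [_ mu0 nu0 _] := mult; split; first exact: lift_feasible.
  do 4!eexists; split; first exact: (lift_multipliers feas smoothP mult).
  apply: (biactive_multipliers feas (C := fun a b => 0 <= a * b)).
    by rewrite mulr0.
  (* The two sign changes cancel in the product. *)
  move=> l l00; rewrite mulrNN.
  by rewrite mulr_ge0 ?mu0 ?nu0 // finset.in_setU l00 orbT.
- move=> [mult munu]; split; first exact: lift_feasible.
  do 4!eexists; split; first exact: (lift_multipliers feas smoothP mult).
  apply: (biactive_multipliers feas
    (C := fun a b => a * b = 0 \/ (0 < a /\ 0 < b))).
    by left; rewrite mulr0.
  by move=> l l00; left; rewrite mulrNN munu.
- move=> [mult munu]; split; first exact: lift_feasible.
  do 4!eexists; split; first exact: (lift_multipliers feas smoothP mult).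
  apply: (biactive_multipliers feas (C := fun a b => 0 <= a /\ 0 <= b)) => //.
  by move=> l /munu[-> ->]; rewrite oppr0.
Qed.
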